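(* Let $G=(V,E)$ be $(D,L)$-Bonnet-Myers sharp with $L=D$. Then $G$ is (isomorphic to) the hypercube $Q^D$.
   Context: All graphs are finite, simple, undirected, unweighted, connected, and have at least one edge. $d$ denotes the combinatorial distance and $\mathrm{diam}(G)=\max_{x,y}d(x,y)$; $x\sim y$ means that $x,y$ are adjacent. For a $D$-regular graph $G=(V,E)$ and $x\in V$, let $\mu_x$ be the probability measure on $V$ giving mass $\frac1{D+1}$ to $x$ and to each of its $D$ neighbours. The Wasserstein distance of probability measures $\mu,\nu$ on $V$ is $W_1(\mu,\nu)=\inf_\pi\sum_{u,v\in V}d(u,v)\pi(u,v)$, where $\pi:V\times V\to[0,1]$ runs over all couplings with marginals $\mu$ and $\nu$. The (modified) Ollivier Ricci curvature of two different vertices $x,y$ is $$\kappa(x,y)=\frac{D+1}{D}\left(1-\frac{W_1(\mu_x,\mu_y)}{d(x,y)}\right).$$ A $D$-regular graph $G$ of diameter $L$ is called $(D,L)$-Bonnet-Myers sharp if $\inf_{x\sim y}\kappa(x,y)=\frac2L$. The hypercube $Q^n$ has vertex set $\{0,1\}^n$, two vertices being adjacent iff their Hamming distance is $1$. *)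

(* Defs.v *)
From mathcomp Require Import all_boot all_order all_algebra.
From mathcomp Require Import boolp classical_sets reals.

Set Implicit Arguments.
Unset Strict Implicit.
Unset Printing Implicit Defensive.

Import Order.TTheory GRing.Theory Num.Theory.

Record sgraph := SGraph {
  vertex :> finType;
  adj : rel vertex;
  adj_sym : symmetric adj;
  adj_irrefl : irreflexive adj }.

Section Combinatorics.
Local Open Scope nat_scope.
Variable G : sgraph.

Definition connected : Prop := forall x y : G, connect (@adj G) x y.

Definition has_edge : Prop := exists x y : G, adj x y.

Definition regular (D : nat) : Prop :=
  forall x : G, #|[set y : G | adj x y]| = D.

Definition walk (k : nat) (x y : G) : bool :=
  [exists p : k.-tuple G, path (@adj G) x p && (last x p == y)].

(* The least length of a walk from x to y.  A shortest walk visits no vertex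
   twice, so lengths below #|G| suffice; the value is #|G| if y is not
   reachable from x, which does not occur in a connected graph. *)
Definition dist (x y : G) : nat :=
  find (fun k => walk k x y) (iota 0 #|G|).

Definition diam : nat := \max_(x : G) \max_(y : G) dist x y.

End Combinatorics.

Section Curvature.
Local Open Scope ring_scope.
Local Open Scope classical_set_scope.
Variables (R : realType) (G : sgraph).

Definition mu (D : nat) (x : G) : G -> R :=
  fun z => if (z == x) || adj x z then (D.+1%:R)^-1 else 0.

Definition coupling (m n : G -> R) (pi : G -> G -> R) : Prop :=
  [/\ forall u v, 0 <= pi u v <= 1,
      forall u, \sum_(v : G) pi u v = m u &
      forall v, \sum_(u : G) pi u v = n v].

Definition transport_cost (pi : G -> G -> R) : R :=
  \sum_(u : G) \sum_(v : G) (dist u v)%:R * pi u v.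

Definition W1 (m n : G -> R) : R :=
  inf [set transport_cost pi | pi in coupling m n].

Definition kappa (D : nat) (x y : G) : R :=
  D.+1%:R / D%:R * (1 - W1 (mu D x) (mu D y) / (dist x y)%:R).

Definition bonnet_myers_sharp (D L : nat) : Prop :=
  [/\ regular G D, diam G = L &
      inf [set k : R | exists x y : G, adj x y /\ k = kappa D x y]
        = 2%:R / L%:R].

End Curvature.

Section Hypercube.
Local Open Scope nat_scope.
Variable n : nat.

Definition hamming (x y : {ffun 'I_n -> bool}) : nat :=
  #|[set i : 'I_n | x i != y i]|.

Definition hypercube_adj : rel {ffun 'I_n -> bool} :=
  fun x y => hamming x y == 1.

Lemma hypercube_adj_sym : symmetric hypercube_adj.
Proof.
move=> x y; rewrite /hypercube_adj /hamming; congr (_ == 1).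
by apply: eq_card => i; rewrite !inE eq_sym.
Qed.

Lemma hypercube_adj_irrefl : irreflexive hypercube_adj.
Proof.
move=> x; rewrite /hypercube_adj /hamming.
by rewrite eq_card0 // => i; rewrite !inE eqxx.
Qed.

Definition hypercube : sgraph :=
  SGraph hypercube_adj_sym hypercube_adj_irrefl.

End Hypercube.

Definition isomorphic (G H : sgraph) : Prop :=
  exists f : G -> H, bijective f /\ forall x y : G, adj (f x) (f y) = adj x y.

(* Main.v *)
Require Import Defs.
From mathcomp Require Import all_boot all_order all_algebra.
From mathcomp Require Import boolp classical_sets reals.
From mathcomp Require Import lra zify.
(* Gives the finite-set lemmas precedence over their classical-set namesakes. *)
Import mathcomp.boot.fintype mathcomp.boot.finset.

Set Implicit Arguments.
Unset Strict Implicit.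
Unset Printing Implicit Defensive.

Import Order.TTheory GRing.Theory Num.Theory.

(** Write B(x) for the ball of radius 1 about x.  For an edge x ~ y the
    curvature bound 2/D says (D+1) W_1(mu_x, mu_y) <= D - 1, and the easy half
    of Kantorovich duality turns it into: for every 1-Lipschitz h,
      sum of h over B(y) <= sum of h over B(x) + D - 1        (short_transport).
    Only two kinds of h are ever needed.

    First, h = d(x0, .).  Telescoping along a geodesic from x0 to z gives
      sum of d(x0, y) over y ~ z  +  2 d(x0, z) <= D + D d(x0, z).
    Summed over z this says that the average of d(x0, .) is at most D/2.  Let
    x0, y0 be at distance D.  Since d(x0, z) + d(y0, z) >= D, both averages
    are exactly D/2, so the inequality is an equality at every z
    (dist_laplace).  If z has level j = d(x0, z), with p neighbours on level
    j + 1 and q on level j - 1, it reads p - q = D - 2j, and p + q <= D gives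
    q <= j; moreover q = j forces p = D - j and leaves no neighbour on level j.

    Second, h = 1 + 1_S - 1_Z on a triangle-free edge w ~ v, where S is a set
    of neighbours of v and Z is the set of neighbours of w, other than v, with
    no neighbour in S.  This gives Hall's condition for the bipartite graph between the two
    neighbourhoods (short_hall).  Sets S with one or two elements suffice, so
    no optimal transport plan and no perfect matching has to be produced.

    Now attach to z the set dirs z of neighbours of x0 that lie on a geodesic
    from x0 to z.  By induction on the level j of z, the graph looks below z
    like the hypercube (cube_like): z has exactly j lower neighbours, dirs z
    has j elements and separates the lower neighbours of z, and two vertices
    with a common lower neighbour and the same dirs are equal.  The core of the
    induction is that for w < v < z on consecutive levels the edge w v is
    triangle-free, so that Hall's condition for S = {z} completes w, v, z to a
    4-cycle through a second lower neighbour of z (complete_diamond); the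
    induction hypothesis makes these neighbours distinct for distinct w, so z
    has at least 1 + (j - 1) lower neighbours, which is the upper bound.

    Finally z |-> dirs z maps G to the D-cube, preserving adjacency and
    injectively on each neighbourhood; as both graphs are D-regular it is
    bijective from each neighbourhood to the corresponding one.  Such a map
    onto a connected graph is a covering, and it has degree one because only
    x0 has an empty set of directions (coords_isomorphic). *)

(** * The path metric *)

Section Distance.
Local Open Scope nat_scope.
Variable G : sgraph.
Hypothesis hconn : connected G.
Implicit Types (x y z : G) (k l : nat).

Lemma walkP k x y :
  reflect (exists p, [/\ size p = k, path (@adj G) x p & last x p = y])
          (walk k x y).
Proof.
apply: (iffP existsP) => [[p /andP[px /eqP py]]|[p [sp px py]]].
  by exists p; rewrite size_tuple.
by exists (tcast sp (in_tuple p)); rewrite val_tcast px py eqxx.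
Qed.

Lemma walk_cat k l x y z : walk k x y -> walk l y z -> walk (k + l) x z.
Proof.
move=> /walkP[p [sp px py]] /walkP[q [sq qy qz]]; apply/walkP; exists (p ++ q).
by rewrite size_cat sp sq cat_path px last_cat py qy.
Qed.

Lemma walk0 x y : walk 0 x y = (x == y).
Proof.
apply/walkP/eqP => [[p [/size0nil -> _]] //|->].
by exists [::].
Qed.

Lemma walk1 x y : walk 1 x y = adj x y.
Proof.
apply/walkP/idP => [[p [sp px py]]|xy]; last by exists [:: y]; rewrite /= xy.
by case: p sp px py => [|a [|b p]] //= _ /andP[xa _] <-.
Qed.

Lemma walk_rcons k x z : walk k.+1 x z -> exists2 y, walk k x y & adj y z.
Proof.
move=> /walkP[p [sp px pz]]; case: p / (lastP p) sp px pz => [//|p y].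
rewrite size_rcons rcons_path last_rcons => -[sp] /andP[px py] <-.
by exists (last x p) => //; apply/walkP; exists p.
Qed.

Lemma walk_sym k x y : walk k x y = walk k y x.
Proof.
suff H x' y' : walk k x' y' -> walk k y' x' by apply/idP/idP; apply: H.
elim: k x' y' => [|k IH] x' y'.
  by rewrite !walk0 eq_sym.
move=> /walk_rcons[z /IH zx zy]; rewrite -add1n; apply: walk_cat zx.
by rewrite walk1 adj_sym.
Qed.

Lemma dist_le_walk k x y : walk k x y -> dist x y <= k.
Proof.
move=> w; rewrite /dist leqNgt; apply/negP => lt_k.
have k_lt : k < #|G|.
  by apply: leq_trans lt_k _; rewrite -{2}(size_iota 0 #|G|) find_size.
by have := before_find 0 lt_k; rewrite nth_iota // add0n w.
Qed.

Lemma walk_dist x y : walk (dist x y) x y.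
Proof.
have /connectP[p px ->] := hconn x y.
case/shortenP: px => q qx uq _.
have sq : size q < #|G|.
  by rewrite (leq_trans _ (max_card (mem (x :: q)))) // (card_uniqP uq).
have hs : has (fun k => walk k x (last x q)) (iota 0 #|G|).
  by apply/hasP; exists (size q); rewrite ?mem_iota //; apply/walkP; exists q.
have := nth_find 0 hs; rewrite nth_iota ?add0n //.
by move: hs; rewrite has_find size_iota.
Qed.

Lemma dist_triangle x y z : dist x z <= dist x y + dist y z.
Proof. exact/dist_le_walk/walk_cat/walk_dist/walk_dist. Qed.

Lemma dist_sym x y : dist x y = dist y x.
Proof.
by apply/eqP; rewrite eqn_leq !dist_le_walk // walk_sym walk_dist.
Qed.

Lemma dist_eq0 x y : (dist x y == 0) = (x == y).
Proof.
apply/eqP/eqP => [d0|->].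
  by apply/eqP; rewrite -walk0 -d0 walk_dist.
by apply/eqP; rewrite -leqn0 dist_le_walk ?walk0.
Qed.

Lemma dist_adj x y : adj x y -> dist x y = 1.
Proof.
move=> xy; apply/eqP; rewrite eqn_leq dist_le_walk ?walk1 // lt0n dist_eq0.
by apply/eqP => e; move: xy; rewrite e adj_irrefl.
Qed.

Lemma dist_adjE x y : (dist x y == 1) = adj x y.
Proof.
apply/eqP/idP => [d1|]; last exact: dist_adj.
by have := walk_dist x y; rewrite d1 walk1.
Qed.

Lemma dist_step x y z : adj y z -> dist x z <= (dist x y).+1.
Proof. by move=> /dist_adj yz; rewrite -addn1 -yz dist_triangle. Qed.

Lemma dist_pred x z k : dist x z = k.+1 -> exists2 y, adj y z & dist x y = k.
Proof.
move=> dk; have := walk_dist x z; rewrite dk => /walk_rcons[y wy yz].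
exists y => //; apply/eqP; rewrite eqn_leq dist_le_walk //=.
by rewrite -ltnS -dk dist_step.
Qed.

End Distance.

(** * The easy half of Kantorovich duality *)

Section Kantorovich.
Local Open Scope ring_scope.
Local Open Scope classical_set_scope.
Variables (R : realType) (G : sgraph) (D : nat).
Hypothesis hreg : regular G D.

Definition nbr (x : G) : {set G} := [set y | adj x y]%SET.
Definition ball (x : G) : {set G} := (x |: nbr x)%SET.

Lemma in_ball (x z : G) : (z \in ball x) = (z == x) || adj x z.
Proof. by rewrite !inE. Qed.

Lemma muE (x z : G) : mu R D x z = (z \in ball x)%:R / D.+1%:R.
Proof. by rewrite /mu in_ball; case: ifP => _; rewrite ?mul1r ?mul0r. Qed.

Lemma sum_mu (F : G -> R) (x : G) :
  \sum_z F z * mu R D x z = (\sum_(z in ball x) F z) / D.+1%:R.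
Proof.
rewrite big_distrl [RHS]big_mkcond /=; apply: eq_bigr => z _.
by rewrite muE; case: ifP; rewrite ?mul1r ?mul0r ?mulr0.
Qed.

Lemma card_ball (x : G) : #|ball x| = D.+1.
Proof. by rewrite cardsU1 inE adj_irrefl /= add1n; congr S; apply: hreg. Qed.

Lemma mass_mu (x : G) : \sum_z mu R D x z = 1.
Proof.
under eq_bigr do rewrite -[mu _ _ _ _]mul1r.
by rewrite (sum_mu (fun=> 1)) sumr_const card_ball divff // pnatr_eq0.
Qed.

Lemma mu_ge0 (x z : G) : 0 <= mu R D x z.
Proof. by rewrite muE divr_ge0 ?ler0n. Qed.

Lemma mu_le1 (x z : G) : mu R D x z <= 1.
Proof.
rewrite muE ler_pdivrMr ?ltr0n // mul1r ler_nat.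
by case: (_ \in _).
Qed.

(** The infimum over an empty set of couplings would be 0, so bounding W1 from
    below requires exhibiting a coupling. *)
Lemma coupling_prod (x y : G) :
  coupling (mu R D x) (mu R D y) (fun u v => mu R D x u * mu R D y v).
Proof.
split=> [u v|u|v].
- by rewrite mulr_ge0 ?mu_ge0 //= mulr_ile1 ?mu_ge0 ?mu_le1.
- by rewrite -big_distrr /= mass_mu mulr1.
- by rewrite -big_distrl /= mass_mu mul1r.
Qed.

(** Against any coupling, the transport cost dominates the total increase of a
    1-Lipschitz function; natural values suffice for all later uses. *)
Lemma kantorovich_le (h : G -> nat) (x y : G) :
  (forall p q, (h q <= h p + dist p q)%N) ->
  (\sum_(q in ball y) h q)%N%:R
    <= (\sum_(p in ball x) h p)%N%:R + D.+1%:R * W1 (mu R D x) (mu R D y).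
Proof.
move=> lip.
suff: (\sum_(q in ball y) h q)%N%:R / D.+1%:R
    - (\sum_(p in ball x) h p)%N%:R / D.+1%:R <= W1 (mu R D x) (mu R D y).
  by rewrite -mulrBl ler_pdivrMr ?ltr0n // mulrC lerBlDl.
rewrite /W1; apply: lb_le_inf.
  by eexists; exists (fun u v => mu R D x u * mu R D y v) => //; exact: coupling_prod.
move=> _ [pi [pi01 pix piy] <-].
rewrite !natr_sum -!sum_mu.
have -> : \sum_z (h z)%:R * mu R D y z = \sum_u \sum_v (h v)%:R * pi u v.
  by rewrite exchange_big; apply: eq_bigr => v _; rewrite -piy big_distrr.
have -> : \sum_z (h z)%:R * mu R D x z = \sum_u \sum_v (h u)%:R * pi u v.
  by apply: eq_bigr => u _; rewrite -pix big_distrr.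
rewrite -sumrB; apply: ler_sum => u _; rewrite -sumrB; apply: ler_sum => v _.
rewrite -mulrBl; apply: ler_wpM2r; first by have /andP[] := pi01 u v.
by rewrite lerBlDl -natrD ler_nat.
Qed.

End Kantorovich.

(** * Consequences of the curvature bound *)

Section Transport.
Local Open Scope nat_scope.
Variables (G : sgraph) (D : nat).

Definition lipschitz (h : G -> nat) := forall p q, h q <= h p + dist p q.

(** The dual form of the bound (D+1) W1 <= D - 1 on the edge xy, with both
    sides increased by 1 to avoid a truncated subtraction. *)
Definition short_transport := forall (x y : G) (h : G -> nat),
  adj x y -> lipschitz h ->
  (\sum_(q in ball y) h q) + 1 <= (\sum_(p in ball x) h p) + D.

Lemma regular_gt0 : has_edge G -> regular G D -> 0 < D.
Proof.
by move=> [x [y xy]] /(_ x) <-; apply/card_gt0P; exists y; rewrite inE.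
Qed.

(** An infimum is a lower bound only of a set bounded below; a finite family
    is bounded below by minus the sum of its absolute values. *)
Lemma finite_inf_le (R : realType) (I : finType) (P : I -> Prop) (k : I -> R) i :
  P i -> (inf [set r | exists j, P j /\ r = k j]%classic <= k i)%R.
Proof.
move=> Pi; apply: ge_inf; last by exists i.
exists (- \sum_j `|k j|)%R => _ [j [_ ->]].
rewrite lerNl (le_trans (ler_norm _)) // normrN (bigD1 j) //= lerDl.
by apply: sumr_ge0.
Qed.

(** With L = D the sharp curvature value 2/L clears to (D+1) (1 - W1) >= 2. *)
Lemma sharp_short_transport (R : realType) :
  connected G -> has_edge G -> bonnet_myers_sharp R G D D -> short_transport.
Proof.
move=> hconn hedge [hreg _ hinf] x y h xy lip.
have D0 := regular_gt0 hedge hreg.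
have := kantorovich_le R hreg x y lip.
set a := (\sum_(q in _) _); set b := (\sum_(q in _) _); set w := W1 _ _ => hk.
have kap : (2%:R / D%:R <= kappa R D x y)%R.
  rewrite -hinf.
  pose P (p : G * G) := is_true (adj p.1 p.2).
  have := @finite_inf_le R _ P (fun p => kappa R D p.1 p.2) (x, y) xy.
  congr (inf _ <= _)%R; apply/seteqP; split => r /=.
    by move=> [[u v] [uv ->]]; exists u, v.
  by move=> [u [v [uv ->]]]; exists (u, v).
move: kap; rewrite /kappa dist_adj // divr1 -/w.
rewrite mulrAC ler_pM2r ?invr_gt0 ?ltr0n // => kap.
rewrite -(ler_nat R) !natrD.
rewrite -natr1 in kap hk; lra.
Qed.

Hypothesis hconn : connected G.
Hypothesis hreg : regular G D.
Hypothesis short : short_transport.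

Lemma lipschitz_dist (x : G) : lipschitz (@dist G x).
Proof. by move=> p q; apply: dist_triangle. Qed.

Lemma sum_ball (h : G -> nat) (x : G) :
  \sum_(q in ball x) h q = h x + \sum_(q in nbr x) h q.
Proof. by rewrite big_setU1 // inE adj_irrefl. Qed.

(** The transport bound for d(x, .), telescoped along a geodesic from x to z,
    starting from the D neighbours at distance 1 around x. *)
Lemma dist_laplace_le (x z : G) :
  (\sum_(y in nbr z) dist x y) + 2 * dist x z <= D + D * dist x z.
Proof.
suff H : forall k z, @dist G x z = k ->
    (\sum_(q in ball z) dist x q) + k <= D + D * k.
  have := H _ _ (erefl (dist x z)); rewrite sum_ball; lia.
elim=> [|k IH] {}z.
  move/eqP; rewrite dist_eq0 // => /eqP <-; rewrite sum_ball.
  have -> : dist x x = 0 by apply/eqP; rewrite dist_eq0.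
  rewrite (eq_bigr (fun=> 1)); last by move=> y; rewrite inE => /dist_adj->.
  by rewrite sum1_card hreg; lia.
move=> /(dist_pred hconn)[y yz /IH hy].
by have := short yz (@lipschitz_dist x); lia.
Qed.

Lemma sum_nbr (f : G -> nat) :
  \sum_z \sum_(y in nbr z) f y = D * \sum_z f z.
Proof.
under eq_bigr do rewrite big_mkcond.
rewrite exchange_big big_distrr /=; apply: eq_bigr => y _.
rewrite -big_mkcond /= sum_nat_const; congr (_ * _).
by rewrite -(hreg y); apply: eq_card => z; rewrite !inE [LHS]inE adj_sym.
Qed.

(** Summing [dist_laplace_le] over z shows that distances to x0 average at most
    D/2, and likewise for y0; the triangle inequality d(x0, z) + d(y0, z) >= D
    leaves no slack anywhere. *)
Lemma dist_laplace (x0 y0 z : G) : dist x0 y0 = D ->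
  (\sum_(y in nbr z) dist x0 y) + 2 * dist x0 z = D + D * dist x0 z.
Proof.
move=> pole.
pose lhs (x u : G) := (\sum_(y in nbr u) dist x y) + 2 * dist x u.
pose rhs (x u : G) := D + D * dist x u.
have sl (x : G) : \sum_u lhs x u = (D + 2) * \sum_u dist x u.
  by rewrite big_split /= sum_nbr -big_distrr mulnDl.
have sr (x : G) : \sum_u rhs x u = #|G| * D + D * \sum_u dist x u.
  by rewrite big_split /= sum_nat_const -big_distrr.
have le_sum (x : G) : (D + 2) * \sum_u dist x u <= #|G| * D + D * \sum_u dist x u.
  by rewrite -sl -sr; apply: leq_sum => u _; apply: dist_laplace_le.
have ge_sum : #|G| * D <= \sum_u dist x0 u + \sum_u dist y0 u.
  rewrite -big_split -sum_nat_const; apply: leq_sum => u _.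
  by rewrite -pole (dist_sym hconn y0) dist_triangle.
have eq_sum : \sum_u lhs x0 u == \sum_u rhs x0 u.
  by rewrite sl sr; move: (le_sum x0) (le_sum y0) ge_sum; lia.
have [_ eqE] :=
  leqif_sum (fun u (_ : predT u) => leqif_eq (dist_laplace_le x0 u)).
by move: eq_sum; rewrite eqE => /forallP/(_ z)/eqP.
Qed.

(** Hall's condition between the neighbourhoods of w and v.  The test function
    is 2 on S, 0 on the neighbours of w other than v that have no neighbour in
    S, and 1 elsewhere: the values 2 and 0 are never taken at adjacent vertices,
    so it is 1-Lipschitz.  Its sum over the D - 1 neighbours of v other than w is
    D - 1 + |S|; over the neighbours of w other than v, it is the number of
    those adjacent to S. *)
Lemma short_hall (w v : G) (S : {set G}) :
  adj w v -> (forall u, adj w u -> ~~ adj v u) -> S \subset nbr v :\ w ->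
  #|S| <= #|[set p in nbr w :\ v | [exists q in S, adj p q]]|.
Proof.
move=> wv notri SN; set T := [set p in _ | _].
have Snw u : u \in S -> adj v u && ~~ adj w u && (u != w).
  move=> uS; have := subsetP SN u uS; rewrite !inE => /andP[-> vu].
  by rewrite vu /= andbT; apply: contraTN vu => /notri.
pose Z := (nbr w :\ v) :\: T.
pose h u := if u \in S then 2 else if u \in Z then 0 else 1.
have lip : lipschitz h.
  move=> p q; case: (eqVneq p q) => [->|pq]; first exact: leq_addr.
  have dpq : 0 < dist p q by rewrite lt0n dist_eq0.
  have [pqA|npqA] := boolP (adj p q).
    have : ~~ ((q \in S) && (p \in Z)).
      apply/negP => /andP[qS]; rewrite inE => /andP[/negP nT pN]; apply: nT.
      by rewrite inE pN; apply/existsP; exists q; rewrite qS.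
    rewrite /h; case: (q \in S); case: (p \in Z) => //= _;
      by case: (p \in S); case: (q \in Z) => //; lia.
  have d2 : 1 < dist p q by rewrite ltn_neqAle eq_sym dist_adjE // npqA.
  by rewrite /h; do !case: ifP => _; lia.
have := short wv lip; rewrite !sum_ball.
have vnw : v \in nbr w by rewrite inE.
have wnv : w \in nbr v by rewrite inE adj_sym.
rewrite (big_setD1 _ vnw) (big_setD1 _ wnv) /=.
have cardv : #|nbr v :\ w| + 1 = D.
  by rewrite -(hreg v) (cardsD1 w (nbr v)) wnv addnC.
have -> : \sum_(q in nbr v :\ w) h q = #|nbr v :\ w| + #|S|.
  rewrite -sum1_card (eq_bigr (fun q => 1 + (q \in S))); last first.
    move=> q; rewrite !inE => /andP[qw vq]; rewrite /h; case: ifP => // _.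
    rewrite ifN // !inE !negb_and (_ : ~~ adj w q) ?orbT //.
    by apply: contraTN vq => /notri.
  rewrite big_split /= sum1_card; congr (_ + _).
  rewrite -sum1_card [RHS]big_mkcond /= [LHS]big_mkcond.
  apply: eq_bigr => q _; case: ifP => [_|]; first by case: (q \in S).
  by case: ifP => // /(subsetP SN) ->.
have -> : \sum_(q in nbr w :\ v) h q = #|T|.
  rewrite -sum1_card [LHS]big_mkcond [RHS]big_mkcond; apply: eq_bigr => q _.
  case: ifP => qN; last by rewrite /T inE qN.
  rewrite /h ifN; last first.
    apply: contraTN qN => /Snw/andP[/andP[_ nwq] _].
    by rewrite !inE negb_and nwq orbT.
  rewrite /Z inE qN andbT.
  by case: (q \in T).
lia.
Qed.
End Transport.

(** * Sets of consecutive sizes *)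

Section Facets.
Local Open Scope nat_scope.
Variable T : finType.
Implicit Types (W P Q : {set T}).

Lemma facet_eq W P e :
  W \subset P -> #|P| = #|W|.+1 -> e \in P -> e \notin W -> P = e |: W.
Proof.
move=> WP cP eP eW; apply/esym/eqP; rewrite eqEcard subUset sub1set eP WP /=.
by rewrite cardsU1 eW cP.
Qed.

Lemma facet_exists W P : W \subset P -> #|P| = #|W|.+1 ->
  exists2 e, e \notin W & P = e |: W.
Proof.
move=> WP cP; have /subsetPn[e eP eW] : ~~ (P \subset W).
  by apply/negP => /subset_leq_card; rewrite cP ltnn.
by exists e => //; apply: facet_eq.
Qed.

Lemma facetsU P Q W : P \subset W -> Q \subset W ->
  #|W| = #|P|.+1 -> #|W| = #|Q|.+1 -> P != Q -> W = P :|: Q.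
Proof.
move=> PW QW cP cQ PQ; have /subsetPn[e eQ eP] : ~~ (Q \subset P).
  by move: PQ; rewrite eq_sym eqEcard -ltnS -cQ -cP leqnn andbT.
apply/eqP; rewrite eqEsubset subUset PW QW andbT.
rewrite (facet_eq PW cP (subsetP QW _ eQ) eP).
by rewrite subUset subsetUl sub1set inE eQ orbT.
Qed.

End Facets.

(** * Levels, and the cube structure below a vertex *)

Section Levels.
Local Open Scope nat_scope.
Variables (G : sgraph) (D : nat) (x0 : G).
Hypothesis hconn : connected G.
Hypothesis hreg : regular G D.
Hypothesis laplace : forall z,
  (\sum_(y in nbr z) dist x0 y) + 2 * dist x0 z = D + D * dist x0 z.
Hypothesis hall : forall w v (S : {set G}),
  adj w v -> (forall u, adj w u -> ~~ adj v u) -> S \subset nbr v :\ w ->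
  #|S| <= #|[set p in nbr w :\ v | [exists q in S, adj p q]]|.
Implicit Types u v w x y z : G.

Definition lev z := dist x0 z.
Definition up z := [set y in nbr z | lev y == (lev z).+1].
Definition dn z := [set y in nbr z | lev z == (lev y).+1].
(** In the cube with origin x0 this is the support of z. *)
Definition dirs z := [set x in nbr x0 | lev z == (dist x z).+1].

Lemma in_dn w z : (w \in dn z) = adj w z && (lev z == (lev w).+1).
Proof. by rewrite !inE adj_sym. Qed.

Lemma dn_adj w z : w \in dn z -> adj w z.
Proof. by rewrite in_dn => /andP[]. Qed.

Lemma dn_lev w z : w \in dn z -> lev z = (lev w).+1.
Proof. by rewrite in_dn => /andP[_ /eqP]. Qed.

Lemma lev_adj y z : adj y z -> lev z <= (lev y).+1.
Proof. exact: dist_step. Qed.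

Lemma dn_exists z : 0 < lev z -> exists w, w \in dn z.
Proof.
move=> z0; have [y yz ly] : exists2 y, adj y z & lev y = (lev z).-1.
  by apply: dist_pred => //; rewrite prednK.
by exists y; rewrite in_dn yz ly prednK ?eqxx.
Qed.

Lemma dn_of_adj p z k : adj p z -> lev z = k.+1 -> lev p <= k -> p \in dn z.
Proof. by move=> pz lz lp; rewrite in_dn pz; have := lev_adj pz; lia. Qed.

(** The equality at z only sees the numbers of upper and lower neighbours,
    because levels of adjacent vertices differ by at most 1. *)
Lemma card_up_dn z : D + #|dn z| = 2 * lev z + #|up z|.
Proof.
have cd (P : pred G) : #|[set y in nbr z | P y]| = \sum_(y in nbr z) P y.
  rewrite -sum1_card [LHS]big_mkcond [RHS]big_mkcond; apply: eq_bigr => y _.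
  by rewrite inE; case: (y \in _) => //=; case: (P y).
have : \sum_(y in nbr z) (lev y + (lev z == (lev y).+1))
     = \sum_(y in nbr z) (lev z + (lev y == (lev z).+1)).
  apply: eq_bigr => y; rewrite inE => zy.
  have := lev_adj zy; rewrite adj_sym in zy; have := lev_adj zy.
  by case: eqP; case: eqP => /=; lia.
rewrite !big_split /= -!cd sum_nat_const hreg -/(dn z) -/(up z).
have : \sum_(y in nbr z) lev y + 2 * lev z = D + D * lev z := laplace z.
lia.
Qed.

Lemma up_dn_disjoint z : [disjoint up z & dn z].
Proof.
apply/pred0P => y /=; apply/negbTE; rewrite !inE.
by apply/negP => /andP[/andP[_ /eqP a] /andP[_ /eqP b]]; lia.
Qed.

Lemma up_dn_sub z : up z :|: dn z \subset nbr z.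
Proof. by apply/subsetP => y; rewrite !inE -andb_orr => /andP[]. Qed.

Lemma card_up_dn_le z : #|up z| + #|dn z| <= D.
Proof.
have := subset_leq_card (up_dn_sub z).
by rewrite cardsU disjoint_setI0 ?up_dn_disjoint // cards0 subn0 hreg.
Qed.

Lemma card_dn_le z : #|dn z| <= lev z.
Proof. by have := card_up_dn z; have := card_up_dn_le z; lia. Qed.

(** With lev z lower neighbours, [card_up_dn] leaves D - lev z upper ones, which
    exhausts the degree. *)
Lemma nbr_up_dn z : #|dn z| = lev z -> nbr z = up z :|: dn z.
Proof.
move=> cz; apply/esym/eqP; rewrite eqEcard up_dn_sub.
rewrite cardsU disjoint_setI0 ?up_dn_disjoint // cards0 subn0 hreg.
by have := card_up_dn z; lia.
Qed.

Lemma adj_up_dn z y : #|dn z| = lev z -> adj z y -> (z \in dn y) || (y \in dn z).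
Proof.
move=> /nbr_up_dn nz zy; have : y \in up z :|: dn z by rewrite -nz inE.
by rewrite in_setU [in z \in dn y]in_dn [y \in up z]inE [y \in nbr z]inE.
Qed.

Lemma dirsS w z : w \in dn z -> dirs w \subset dirs z.
Proof.
move=> wz; apply/subsetP => x; rewrite !inE => /andP[x0x /eqP lw].
have lz := dn_lev wz; rewrite x0x /=.
have := dist_step hconn x (dn_adj wz).
have := dist_triangle hconn x0 x z; rewrite (dist_adj hconn x0x) -/(lev z).
by lia.
Qed.

(** Below level 2 this fails: at level 1, the only direction of z is z itself,
    while the origin has none. *)
Lemma dirs_cover z x : 1 < lev z -> x \in dirs z ->
  exists2 w, w \in dn z & x \in dirs w.
Proof.
rewrite inE [x \in _]inE => lz /andP[x0x /eqP dz].
have [k dk] : exists k, dist x z = k.+1 by exists (dist x z).-1; lia.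
have [y yz dy] := dist_pred hconn dk.
have := dist_triangle hconn x0 x y; rewrite (dist_adj hconn x0x) -/(lev y) dy => ly.
have yd : y \in dn z by apply: dn_of_adj yz _ _; [rewrite dz dk|rewrite add1n in ly].
by exists y => //; rewrite !inE x0x dy -eqSS -(dn_lev yd) dz dk eqxx.
Qed.

(** The last clause says that dirs separates the upper neighbours of w; it is
    attached to their level, not to that of w, so that the induction on levels
    has access to it. *)
Definition cube_like z : Prop :=
  [/\ #|dirs z| = lev z, #|dn z| = lev z, {in dn z &, injective dirs} &
      forall z' w, w \in dn z -> w \in dn z' -> dirs z = dirs z' -> z = z'].

Section Step.
Variable z : G.
Hypothesis IH : forall y, lev y < lev z -> cube_like y.

Lemma IH_dn v : v \in dn z -> cube_like v.
Proof. by move=> /dn_lev lz; apply: IH; rewrite lz. Qed.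

Lemma IH_dn2 v w : v \in dn z -> w \in dn v -> cube_like w.
Proof. by move=> /dn_lev lz /dn_lev lv; apply: IH; lia. Qed.

Lemma card_facet v w : v \in dn z -> w \in dn v -> #|dirs v| = #|dirs w|.+1.
Proof.
move=> vz wv; have [-> _ _ _] := IH_dn vz.
by have [-> _ _ _] := IH_dn2 vz wv; apply: dn_lev.
Qed.

(** Neighbours of w and of v lie on levels of opposite parities, since neither
    vertex has a neighbour on its own level. *)
Lemma no_triangle v w : v \in dn z -> w \in dn v -> forall u, adj w u -> ~~ adj v u.
Proof.
move=> vz wv u wu; apply/negP => vu.
have [_ cv _ _] := IH_dn vz; have [_ cw _ _] := IH_dn2 vz wv.
have lv := dn_lev wv.
by case/orP: (adj_up_dn cv vu) => /dn_lev; case/orP: (adj_up_dn cw wu) => /dn_lev; lia.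
Qed.

(** Hall's condition on the edge wv for upper neighbours of v.  A neighbour p
    of w adjacent to some q in S is squeezed onto the level of v, hence is an
    upper neighbour of w and a lower neighbour of q. *)
Lemma hall_dn v w (S : {set G}) : v \in dn z -> w \in dn v ->
  {in S, forall q, v \in dn q} ->
  exists2 T : {set G}, #|S| <= #|T| &
    {in T, forall p, [/\ p != v, w \in dn p & exists2 q, q \in S & p \in dn q]}.
Proof.
move=> vz wv Sv; have lv := dn_lev wv.
have SN : S \subset nbr v :\ w.
  apply/subsetP => q /Sv vq; rewrite !inE (dn_adj vq) andbT.
  by apply/eqP => qw; have := dn_lev vq; rewrite qw; lia.
exists [set p in nbr w :\ v | [exists q in S, adj p q]].
  exact: hall (dn_adj wv) (no_triangle vz wv) SN.
move=> p; rewrite inE in_setD1 [p \in nbr w]inE => /andP[/andP[pv wp]].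
move=> /existsP[q /andP[qS pq]].
have lq := dn_lev (Sv q qS); have := lev_adj wp; have := lev_adj pq => l1 l2.
split=> //; first by rewrite in_dn wp; lia.
by exists q => //; apply: (dn_of_adj pq lq); lia.
Qed.

(** The path w, v, z closes to a 4-cycle; every lower neighbour of z besides a
    given one is produced in this way. *)
Lemma complete_diamond v w : v \in dn z -> w \in dn v ->
  exists v', [&& v' \in dn z, v' != v & w \in dn v'].
Proof.
move=> vz wv; have [|T] := @hall_dn v w [set z] vz wv.
  by move=> q /set1P->.
rewrite cards1 => /card_gt0P[p pT] /(_ p pT)[pv wp [q /set1P-> pz]].
by exists p; rewrite pv wp pz.
Qed.

(** Two common lower neighbours w, w' would give v and v' the same directions,
    namely those of w together with those of w'. *)
Lemma common_dn_unique v v' w w' : v \in dn z -> v' \in dn z -> v != v' ->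
  w \in dn v -> w \in dn v' -> w' \in dn v -> w' \in dn v' -> w = w'.
Proof.
move=> vz v'z vv' wv wv' w'v w'v'; apply/eqP; apply: contraNT vv' => ww'.
have [_ _ injv upv] := IH_dn vz.
have dd : dirs w != dirs w' by apply: contraNneq ww' => /injv->.
apply/eqP; apply: (upv v' w wv wv').
have -> := facetsU (dirsS wv) (dirsS w'v) (card_facet vz wv) (card_facet vz w'v) dd.
by rewrite (facetsU (dirsS wv') (dirsS w'v') _ _ dd) //; apply: card_facet.
Qed.

(** By [complete_diamond], each lower neighbour w of v yields a lower neighbour
    g w of z other than v, and g is injective by [common_dn_unique].  This is
    lev z - 1 vertices besides v, as many as [card_dn_le] allows: so g reaches
    every lower neighbour of z other than v. *)
Lemma dn_fan v : v \in dn z -> #|dn z| = lev z /\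
  exists g : G -> G, forall v', v' \in dn z -> v' != v ->
    exists w, [/\ w \in dn v, w \in dn v' & v' = g w].
Proof.
move=> vz.
pose g w := odflt v [pick v' | [&& v' \in dn z, v' != v & w \in dn v']].
have gP w : w \in dn v -> [&& g w \in dn z, g w != v & w \in dn (g w)].
  move=> wv; rewrite /g; case: pickP => [//|no].
  by have [v'] := complete_diamond vz wv; rewrite no.
have ginj : {in dn v &, injective g}.
  move=> w w' wv w'v gg; have /and3P[gz gv wg] := gP w wv.
  have /and3P[_ _ w'g] := gP w' w'v; rewrite -gg in w'g.
  by apply: (common_dn_unique vz gz) => //; rewrite eq_sym.
have gsub : g @: dn v \subset dn z :\ v.
  by apply/subsetP => _ /imsetP[w /gP/and3P[gz gv _] ->]; rewrite in_setD1 gz gv.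
have cz : #|dn z| = #|dn z :\ v|.+1 by rewrite (cardsD1 v) vz.
have cg : #|g @: dn v| = lev v by rewrite card_in_imset //; case: (IH_dn vz).
have := subset_leq_card gsub; have := card_dn_le z; have := dn_lev vz => lz le ge.
split; first by lia.
exists g => v' v'z v'v.
have /eqP eqg : g @: dn v == dn z :\ v by rewrite eqEcard gsub; lia.
have : v' \in g @: dn v by rewrite eqg in_setD1 v'v.
by move=> /imsetP[w wv ->]; exists w; have /and3P[_ _ ->] := gP w wv.
Qed.

Lemma dirs_inj_dn : {in dn z &, injective dirs}.
Proof.
move=> v v' vz v'z dd; apply/eqP; rewrite eq_sym; apply/negPn/negP => vv'.
have [_ [g /(_ v' v'z vv')[w [wv wv' _]]]] := dn_fan vz.
have [_ _ _ upv] := IH_dn vz.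
by move: vv'; rewrite (upv v' w wv wv' dd) eqxx.
Qed.

Hypothesis lz : 1 < lev z.

Lemma card_dirs_ge : lev z <= #|dirs z|.
Proof.
have [v vz] := dn_exists (ltnW lz); have lv := dn_lev vz.
have [w wv] : exists w, w \in dn v by apply: dn_exists; lia.
have [v' /and3P[v'z v'v wv']] := complete_diamond vz wv.
have [cv _ _ _] := IH_dn vz; have [cv' _ _ _] := IH_dn v'z.
rewrite lv -cv; apply: proper_card; rewrite properE dirsS //=.
apply/negP => zv; move/eqP: v'v; apply; apply: dirs_inj_dn => //.
apply/eqP; rewrite eqEcard (subset_trans (dirsS v'z) zv) cv cv'.
by have := dn_lev v'z; lia.
Qed.

(** Suppose that x and x' are two directions of z outside dirs v, coming from
    lower neighbours v1 = g w1 and v2 = g w2 of z.  A common lower neighbour u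
    of v1 and v2 has neither x nor x' as a direction, so it coincides with w1
    and with w2, whence v1 = v2 and x = x'. *)
Lemma new_dir_unique v : v \in dn z -> #|dirs z :\: dirs v| <= 1.
Proof.
move=> vz; have [_ [g gP]] := dn_fan vz.
have key x : x \in dirs z :\: dirs v -> exists v1 w1,
    [/\ v1 \in dn z, w1 \in dn v, w1 \in dn v1, v1 = g w1
       & dirs v1 = x |: dirs w1].
  rewrite inE => /andP[xv xz]; have [v1 v1z xv1] := dirs_cover lz xz.
  have v1v : v1 != v by apply: contraNneq xv => <-.
  have [w1 [w1v w1v1 v1g]] := gP v1 v1z v1v; exists v1, w1; split=> //.
  apply: facet_eq (dirsS w1v1) (card_facet v1z w1v1) xv1 _.
  by apply: contraNN xv; apply: subsetP (dirsS w1v) x.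
apply/card_le1_eqP => x x' xz x'z; apply/eqP/negPn/negP => xx'.
have [v1 [w1 [v1z w1v w1v1 g1 d1]]] := key x xz.
have [v2 [w2 [v2z w2v w2v2 g2 d2]]] := key x' x'z.
move: xz x'z; rewrite !in_setD => /andP[xv _] /andP[x'v _].
have x2 : x \notin dirs v2.
  rewrite d2 in_setU1 eq_sym (negbTE xx') /=.
  by apply: contraNN xv; apply: subsetP (dirsS w2v) x.
have x1' : x' \notin dirs v1.
  rewrite d1 in_setU1 (negbTE xx') /=.
  by apply: contraNN x'v; apply: subsetP (dirsS w1v) x'.
have v12 : v2 != v1 by apply: contraNneq x2 => ->; rewrite d1 setU11.
have [_ [_ /(_ v2 v2z v12)[u [uv1 uv2 _]]]] := dn_fan v1z.
have below a b y : a \in dn z -> b \in dn a -> u \in dn a ->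
    dirs a = y |: dirs b -> y \notin dirs u -> u = b.
  move=> az ba ua da yu; have [_ _ inja _] := IH_dn az; apply: inja => //.
  apply/eqP; rewrite eqEcard -ltnS -!(card_facet az) // leqnn andbT.
  apply/subsetP => s su.
  have := subsetP (dirsS ua) s su; rewrite da in_setU1.
  by case/predU1P => // sy; move: yu; rewrite -sy su.
have uw1 : u = w1.
  apply: below d1 _ => //; by apply: contraNN x2; apply: subsetP (dirsS uv2) x.
have uw2 : u = w2.
  apply: below d2 _ => //; by apply: contraNN x1'; apply: subsetP (dirsS uv1) x'.
by move: v12; rewrite g1 g2 -uw1 -uw2 eqxx.
Qed.

Lemma card_dirs : #|dirs z| = lev z.
Proof.
apply/eqP; rewrite eqn_leq card_dirs_ge andbT.
have [v vz] := dn_exists (ltnW lz); have [cv _ _ _] := IH_dn vz.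
rewrite -(cardsID (dirs v)) (setIidPr (dirsS vz)) cv (dn_lev vz).
by rewrite -addn1 leq_add2l new_dir_unique.
Qed.

(** Choose w below v.  Hall's condition for S = {z, z'} provides two upper
    neighbours p1, p2 of w besides v.  Then dirs v, dirs p1, dirs p2 are
    pairwise distinct and lie strictly between dirs w and dirs z, where there
    is room for only two sets, since the sizes differ by 2. *)
Lemma dirs_inj_up z' v : v \in dn z -> v \in dn z' -> dirs z = dirs z' -> z = z'.
Proof.
move=> vz vz' dd; apply/eqP/negPn/negP => zz'.
have lv := dn_lev vz; have lv' := dn_lev vz'.
have [w wv] : exists w, w \in dn v by apply: dn_exists; lia.
have [|T] := @hall_dn v w [set z; z'] vz wv.
  by move=> q /set2P[]->.
rewrite cards2 zz' => /card_gt1P[p1 [p2 [p1T p2T p12]]] TP.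
have pP p : p \in T -> [/\ cube_like p, p != v, w \in dn p & dirs p \subset dirs z].
  move=> /TP[pv wp [q qS pq]]; split=> //.
    by apply: IH; move: (dn_lev pq) => lq; case/set2P: qS lq => ->; lia.
  by case/set2P: qS pq => -> /dirsS //; rewrite dd.
have cw : #|dirs w| = lev w by case: (IH_dn2 vz wv).
have cv : #|dirs v| = lev v by case: (IH_dn vz).
have lvw := dn_lev wv.
have [[c1 _ _ up1] p1v wp1 s1] := pP p1 p1T; have l1 := dn_lev wp1.
have [[c2 _ _ up2] p2v wp2 s2] := pP p2 p2T; have l2 := dn_lev wp2.
have dv1 : dirs v != dirs p1 by apply: contraNneq p1v => /esym/(up1 v w wp1 wv)->.
have cz := card_dirs.
have e2 : exists2 e, e \notin dirs w & dirs p2 = e |: dirs w.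
  by apply: facet_exists (dirsS wp2) _; rewrite c2 cw.
case: e2 => e ew dp2.
have cov : dirs z = dirs v :|: dirs p1.
  by apply: facetsU dv1; rewrite ?s1 ?dirsS // cz lv ?cv // c1 l1 lvw.
have : e \in dirs v :|: dirs p1.
  by rewrite -cov; apply: (subsetP s2); rewrite dp2 setU11.
case/setUP => [ev|e1].
  have dv : dirs v = e |: dirs w by apply: facet_eq (dirsS wv) _ ev ew; rewrite cv cw.
  by move: p2v; rewrite (up2 v w wp2 wv) ?eqxx // dp2 dv.
have dp1 : dirs p1 = e |: dirs w by apply: facet_eq (dirsS wp1) _ e1 ew; rewrite c1 cw.
by move: p12; rewrite (up2 p1 w wp2 wp1) ?eqxx // dp2 dp1.
Qed.

End Step.

Lemma lev_eq0 z : (lev z == 0) = (z == x0).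
Proof. by rewrite dist_eq0 // eq_sym. Qed.

Lemma dirs0 : dirs x0 = set0.
Proof.
apply/setP => x; rewrite !inE; have /eqP-> : lev x0 == 0 by rewrite lev_eq0.
by rewrite andbF.
Qed.

Lemma dirs1 z : lev z = 1 -> dirs z = [set z].
Proof.
move=> l1; apply/setP => x; rewrite !inE l1 eqSS eq_sym dist_eq0 //.
by case: eqP => [->|]; rewrite ?andbF // -dist_adjE // andbT -/(lev z) l1.
Qed.

(** Levels 0 and 1 are treated apart: the inductive step descends two levels. *)
Lemma cube_like_all z : cube_like z.
Proof.
elim: {z}(lev z).+1 {-2}z (ltnSn (lev z)) => // n IHn z; rewrite ltnS => ln.
have IH y : lev y < lev z -> cube_like y by move=> yz; apply: IHn; lia.
have [lz|l1|l0] := ltngtP (lev z) 1; last first.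
- have [w wz] : exists w, w \in dn z by apply: dn_exists; rewrite l0.
  have dnx0 y : y \in dn z -> y = x0.
    by move=> /dn_lev; rewrite l0 => -[ly]; apply/eqP; rewrite -lev_eq0 -ly.
  split; first by rewrite dirs1 ?cards1.
  + rewrite l0; apply/eqP; rewrite eqn_leq -{1}l0 card_dn_le card_gt0.
    by apply/set0Pn; exists w.
  + by move=> y y' /dnx0-> /dnx0->.
  + move=> z' u uz uz'; rewrite dirs1 // dirs1; last first.
      by rewrite (dn_lev uz') -(dn_lev uz).
    by move/set1_inj.
- have [v vz] := dn_exists (ltnW l1); split.
  + exact: card_dirs.
  + by have [] := dn_fan IH vz.
  + exact: dirs_inj_dn.
  + by move=> z' w; apply: dirs_inj_up.
- have z0 : lev z = 0 by lia.
  have dn0 y : y \notin dn z by apply/negP => /dn_lev; rewrite z0.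
  split.
  + by move/eqP: (z0); rewrite lev_eq0 => /eqP zx; rewrite zx dirs0 cards0 -zx z0.
  + by rewrite z0; apply: eq_card0 => y; apply/negbTE.
  + by move=> y y' yz; move: (dn0 y); rewrite yz.
  + by move=> z' w wz; move: (dn0 w); rewrite wz.
Qed.

Lemma dirs_inj_nbr z : {in nbr z &, injective dirs}.
Proof.
move=> y y'; rewrite !inE => zy zy' dd.
have [_ cz injz _] := cube_like_all z.
have [cy _ _ upy] := cube_like_all y; have [cy' _ _ _] := cube_like_all y'.
have ll : lev y = lev y' by rewrite -cy -cy' dd.
case/orP: (adj_up_dn cz zy) => yz; case/orP: (adj_up_dn cz zy') => y'z.
- exact: (upy y' z).
- by have := dn_lev yz; have := dn_lev y'z; lia.
- by have := dn_lev yz; have := dn_lev y'z; lia.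
- exact: injz.
Qed.

(** * The isomorphism with the hypercube *)

Definition dir (i : 'I_D) : G := enum_val (cast_ord (esym (hreg x0)) i).

Lemma dir_inj : injective dir.
Proof. by move=> i j /enum_val_inj/cast_ord_inj. Qed.

Lemma dir_onto x : x \in nbr x0 -> exists i, x = dir i.
Proof.
move=> xN; exists (cast_ord (hreg x0) (enum_rank_in xN x)).
by rewrite /dir cast_ordK enum_rankK_in.
Qed.

Definition coords z : {ffun 'I_D -> bool} := [ffun i => dir i \in dirs z].

Lemma coords_dirs z z' : coords z = coords z' -> dirs z = dirs z'.
Proof.
move=> cc; apply/setP => x; have [/dir_onto[i ->]|nx] := boolP (x \in nbr x0).
  by have /ffunP/(_ i) := cc; rewrite !ffunE.
by rewrite [LHS]in_set [RHS]in_set (negbTE nx).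
Qed.

Lemma coords_dn w z : w \in dn z -> hypercube_adj (coords w) (coords z).
Proof.
move=> wz; have [cz _ _ _] := cube_like_all z; have [cw _ _ _] := cube_like_all w.
have [|e ew dz] := facet_exists (dirsS wz); first by rewrite cz cw; apply: dn_lev.
have [i ei] : exists i, e = dir i.
  have : e \in dirs z by rewrite dz setU11.
  by rewrite in_set => /andP[/dir_onto].
rewrite /hypercube_adj /hamming (_ : [set _ | _] = [set i]) ?cards1 //.
apply/setP => j; rewrite !in_set !ffunE dz in_setU1 ei (inj_eq dir_inj) in_set1.
by have [->|_] := eqVneq j i; rewrite -?ei ?(negbTE ew) ?eqxx.
Qed.

Lemma coords_adj z y : adj z y -> hypercube_adj (coords z) (coords y).
Proof.
have [_ cz _ _] := cube_like_all z.
move=> /(adj_up_dn cz)/orP[/coords_dn //|/coords_dn].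
by rewrite hypercube_adj_sym.
Qed.

Lemma hypercube_degree_le (f : {ffun 'I_D -> bool}) :
  #|[set g | hypercube_adj f g]| <= D.
Proof.
pose flip i := [ffun j => f j (+) (j == i)].
rewrite -[leqRHS]card_ord -cardsT; apply: leq_trans (leq_imset_card flip _).
apply/subset_leq_card/subsetP => g; rewrite inE => /cards1P[i fg].
apply/imsetP; exists i => //; apply/ffunP => j; rewrite ffunE.
by have /setP/(_ j) := fg; rewrite !inE => <-; case: (f j); case: (g j).
Qed.

(** The D neighbours of z have D distinct images among the at most D neighbours
    of its image. *)
Lemma coords_nbr z : coords @: nbr z = [set g | hypercube_adj (coords z) g].
Proof.
apply/eqP; rewrite eqEcard; apply/andP; split.
  by apply/subsetP => _ /imsetP[y zy ->]; rewrite inE coords_adj // -[adj _ _]in_set.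
rewrite card_in_imset; last first.
  by move=> y y' yz y'z /coords_dirs; exact: (dirs_inj_nbr yz y'z).
by rewrite hreg hypercube_degree_le.
Qed.

(** By induction on the level: a lower neighbour w of z lifts to a neighbour w'
    of z' with the same image, so w = w' and z, z' have a common lower
    neighbour. *)
Lemma coords_inj : injective coords.
Proof.
move=> z; have [n ln] := ubnP (lev z); elim: n z ln => // n IHn z ln z' zz'.
have [cz _ _ upz] := cube_like_all z; have [cz' _ _ _] := cube_like_all z'.
have dz := coords_dirs zz'; have ll : lev z = lev z' by rewrite -cz -cz' dz.
have [z0|] := posnP (lev z).
  have /eqP z'0 : lev z' = 0 by rewrite -ll.
  by move/eqP: z0 z'0; rewrite !lev_eq0 => /eqP-> /eqP->.
move=> /dn_exists[w wz]; have lw := dn_lev wz.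
have : coords w \in coords @: nbr z'.
  by rewrite coords_nbr inE -zz' hypercube_adj_sym coords_dn.
move=> /imsetP[w' w'z' ww']; have ww : w = w' by apply: IHn => //; lia.
apply: (upz z' w wz) => //; rewrite in_dn -ll lw eqxx andbT adj_sym ww.
by move: w'z'; rewrite inE.
Qed.

(** The image contains the origin and is closed under adjacency, since
    [coords_nbr] reaches every neighbour of an image; removing the elements of
    the support one by one connects any vertex to the origin. *)
Lemma coords_onto g : exists z, coords z = g.
Proof.
have [n ln] := ubnP #|[set i | g i]|; elim: n g ln => // n IHn g ln.
have [g0|[i]] := set_0Vmem [set i | g i].
  exists x0; apply/ffunP => j; rewrite ffunE dirs0 inE.
  by have /setP/(_ j) := g0; rewrite !inE.
rewrite inE => gi; pose g' : {ffun 'I_D -> bool} := [ffun j => g j && (j != i)].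
have [|z zg'] := IHn g'.
  rewrite -ltnS; apply: leq_trans ln; rewrite ltnS; apply: proper_card.
  apply/properP; split; first by apply/subsetP => j; rewrite !inE ffunE => /andP[].
  by exists i; rewrite !inE // ffunE eqxx andbF.
have : g \in coords @: nbr z; last by move=> /imsetP[y _ ->]; exists y.
rewrite coords_nbr inE zg' /hypercube_adj /hamming.
rewrite (_ : [set _ | _] = [set i]) ?cards1 //.
apply/setP => j; rewrite !inE ffunE.
by have [->|_] := eqVneq j i; rewrite ?gi //= andbT eqxx.
Qed.

Lemma coords_isomorphic : isomorphic G (hypercube D).
Proof.
exists coords; split.
  apply: (inj_card_bij coords_inj); rewrite -(card_codom coords_inj).
  by apply/subset_leq_card/subsetP => g _; have [z <-] := coords_onto g; apply: codom_f.
move=> x y /=; apply/idP/idP; last exact: coords_adj.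
move=> xy; have : coords y \in coords @: nbr x by rewrite coords_nbr inE.
by rewrite mem_imset ?inE //; apply: coords_inj.
Qed.

End Levels.

Theorem theorem9p6 (R : realType) (G : sgraph) (D L : nat)
    (hconn : connected G) (hedge : has_edge G)
    (hsharp : bonnet_myers_sharp R G D L) (hLD : L = D) :
  isomorphic G (hypercube D).
Proof.
rewrite hLD in hsharp.
have short := sharp_short_transport hconn hedge hsharp.
have [hreg hdiam _] := hsharp.
have [a _] := hedge.
have G0 : 0 < #|G| by apply/card_gt0P; exists a.
have [x0 ex] := bigop.eq_bigmax (fun x : G => \max_(y : G) dist x y)%N G0.
have [y0 ey] := bigop.eq_bigmax (fun y : G => dist x0 y) G0.
have pole : dist x0 y0 = D by rewrite -ey -ex.
apply: (@coords_isomorphic G D x0 hconn hreg) => [z|w v S].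
  exact: dist_laplace pole.
exact: short_hall.
Qed.
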